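(* For fixed $\alpha$, consider in coordinates $(x,y,z)$ the constant metric tensor $$g=(g_{ij})=\begin{pmatrix}1&0&0\\0&1&-(1-\alpha)\\0&-(1-\alpha)&1\end{pmatrix},$$ which satisfies $(x,y,z)\,g\,(x,y,z)^T=x^2+y^2+z^2-2(1-\alpha)yz$. Its $(y,z)$ block has determinant $1-(1-\alpha)^2=\alpha(2-\alpha)$, so $|g|=\alpha(2-\alpha)$, and the inverse metric is $$(g^{ij})=\begin{pmatrix}1&0&0\\0&\frac{1}{\alpha(2-\alpha)}&\frac{1-\alpha}{\alpha(2-\alpha)}\\0&\frac{1-\alpha}{\alpha(2-\alpha)}&\frac{1}{\alpha(2-\alpha)}\end{pmatrix},$$ that is, $\sum_k g^{ik}g_{kj}=\delta^i_j$. Since $\sqrt{|g|}=\sqrt{\alpha(2-\alpha)}$ is constant, the Laplace–Beltrami operator is $\Delta w=\sum_{i,j}g^{ij}\partial_i\partial_jw$, i.e. $$\Delta w=\partial_x^2w+\frac{1}{\alpha(2-\alpha)}\partial_y^2w+2\,\frac{1-\alpha}{\alpha(2-\alpha)}\partial_y\partial_zw+\frac{1}{\alpha(2-\alpha)}\partial_z^2w .$$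
   Context: The Trinition inner product of a vector $v=(x,y,z)$ with itself is $\langle v,v\rangle=x^2+y^2+z^2-2(1-\alpha)yz$, where $\alpha$ is the real deformation parameter of the Trinition system; $g$ is the matrix of this quadratic form. The Laplace–Beltrami operator of a metric $g$ acting on a scalar function $w$ is $\Delta w=\sum_{i,j}\frac{1}{\sqrt{|g|}}\partial_i\left(\sqrt{|g|}\,g^{ij}\partial_jw\right)$, where $|g|$ denotes the determinant of $g$ and $(g^{ij})$ its inverse. *)

(* Defs.v *)
From HB Require Import structures.
From mathcomp Require Export all_boot all_order all_algebra.
From mathcomp Require Export all_classical all_reals all_analysis.
Export Order.TTheory GRing.Theory Num.Theory.
Export numFieldNormedType.Exports.

Set Implicit Arguments.
Unset Strict Implicit.
Unset Printing Implicit Defensive.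

Local Open Scope classical_set_scope.
Local Open Scope ring_scope.

Definition partial (R : realType) (n : nat) (i : 'I_n) (f : 'rV[R]_n -> R) :
    'rV[R]_n -> R :=
  fun p => 'D_(delta_mx 0 i) f p.

(* f is of class C^k on U: its iterated partial derivatives of order at most k
   exist and are continuous at every point of U. Meant for U open: f is total,
   and the limits are taken in the whole space. *)
Fixpoint classC (R : realType) (n : nat) (k : nat) (U : set 'rV[R]_n)
    (f : 'rV[R]_n -> R) : Prop :=
  (forall p, U p -> {for p, continuous f}) /\
  if k is k'.+1 then
    forall i : 'I_n, (forall p, U p -> derivable f p (delta_mx 0 i)) /\
                     classC k' U (partial i f)
  else True.

(* g p is the matrix (g_ij) at p, and invmx (g p) is (g^ij). Num.sqrt is 0 on
   negative reals, so this is meaningful only where \det (g p) > 0. *)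
Definition laplace_beltrami (R : realType) (n : nat)
    (g : 'rV[R]_n -> 'M[R]_n) (w : 'rV[R]_n -> R) : 'rV[R]_n -> R :=
  fun p => \sum_i \sum_j
    (Num.sqrt (\det (g p)))^-1 *
    partial i (fun q => Num.sqrt (\det (g q)) * invmx (g q) i j *
                        partial j w q) p.

Definition mx3 (R : realType) (rows : seq (seq R)) : 'M[R]_3 :=
  \matrix_(i, j) (nth [::] rows i)`_j.

Definition trinition_mx (R : realType) (alpha : R) : 'M[R]_3 :=
  mx3 [:: [:: 1; 0; 0];
          [:: 0; 1; - (1 - alpha)];
          [:: 0; - (1 - alpha); 1]].

Definition trinition_metric (R : realType) (alpha : R) :
    'rV[R]_3 -> 'M[R]_3 :=
  fun=> trinition_mx alpha.

Definition trinition_inv (R : realType) (alpha : R) : 'M[R]_3 :=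
  let d := alpha * (2 - alpha) in
  mx3 [:: [:: 1; 0; 0];
          [:: 0; 1 / d; (1 - alpha) / d];
          [:: 0; (1 - alpha) / d; 1 / d]].

Definition vec3 (R : realType) (x y z : R) : 'rV[R]_3 :=
  \row_j [:: x; y; z]`_j.

Definition ix : 'I_3 := @Ordinal 3 0 isT.
Definition iy : 'I_3 := @Ordinal 3 1 isT.
Definition iz : 'I_3 := @Ordinal 3 2 isT.

(* Main.v *)
Require Import Defs.
From mathcomp Require Import ring.

Set Implicit Arguments.
Unset Strict Implicit.
Unset Printing Implicit Defensive.

Local Open Scope classical_set_scope.
Local Open Scope ring_scope.

(** The metric is constant, so the factors sqrt |g| and g^ij in the
    Laplace-Beltrami operator are constants: they leave the derivative, the two
    square roots cancel because the determinant is positive, and what remains is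
    the contraction of the inverse matrix with the second partial derivatives
    ([laplace_beltrami_cst]). The determinant and the inverse of the 3 x 3
    matrix are entrywise computations ([trinition_det], [trinition_mulVmx]).

    The contraction contains the two mixed terms in y and z with the same
    coefficient; collecting them into one term needs the symmetry of second
    derivatives. This is proved for directional derivatives in a normed module
    ([derive_comm]), by the classical argument on the second difference
      f (p + e u + e v) - f (p + e u) - f (p + e v) + f p,
    which is symmetric in u and v. Two applications of the mean value theorem
    write it as e^2 times D_v D_u f at a point near p
    ([second_difference_MVT]), and exchanging u and v, as e^2 times D_u D_v f at
    another such point; continuity of both derivatives at p concludes. *)

(** The mean value theorem is about functions of a real variable; this
    brings directional derivatives to it. *)
Lemma is_derive_line (R : numFieldType) (V W : normedModType R) (f : V -> W)
    (p v : V) (t : R) (df : W) :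
  is_derive (p + t *: v) v f df ->
  is_derive t 1 (fun s : R => f (p + s *: v)) df.
Proof.
have quotientE : (fun h : R => h^-1 *: (((fun s => f (p + s *: v)) \o shift t)
      (h *: (1 : R)) - f (p + t *: v))) =
    (fun h : R => h^-1 *: ((f \o shift (p + t *: v)) (h *: v) -
      f (p + t *: v))).
  apply/funext => h /=.
  by rewrite [h *: 1]mulr1 scalerDl addrCA.
case=> fd fdE.
by split; [rewrite /derivable quotientE|rewrite /derive quotientE].
Qed.

(** The second difference is the increment on [0, e] of
    s |-> f (p + e v + s u) - f (p + s u). The mean value theorem turns it into
    e times the increment of D_u f along v from p + s u, for some s, and a
    second use of the theorem gives D_v D_u f. *)
Lemma second_difference_MVT (R : realType) (V : normedModType R) (f : V -> R)
    (p u v : V) (e : R) :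
  0 < e ->
  (forall s t, 0 <= s <= e -> 0 <= t <= e ->
    derivable f (p + s *: u + t *: v) u /\
    derivable ('D_u f) (p + s *: u + t *: v) v) ->
  exists s t, [/\ 0 <= s <= e, 0 <= t <= e &
    f (p + e *: u + e *: v) - f (p + e *: u) - f (p + e *: v) + f p =
    'D_v ('D_u f) (p + s *: u + t *: v) * e ^+ 2].
Proof.
move=> e0 fd; have ee : 0 <= e <= e by rewrite lexx ltW.
have oe : 0 <= (0 : R) <= e by rewrite lexx ltW.
pose phi s := f (p + e *: v + s *: u) - f (p + s *: u).
pose dphi s := 'D_u f (p + e *: v + s *: u) - 'D_u f (p + s *: u).
have dphiP s : 0 <= s <= e -> is_derive s 1 phi (dphi s).
  move=> s0e; have [du_e _] := fd _ _ s0e ee; have [du_0 _] := fd _ _ s0e oe.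
  rewrite scale0r addr0 in du_0; rewrite addrAC in du_e.
  have phi_e := is_derive_line (derivableP du_e).
  have phi_0 := is_derive_line (derivableP du_0).
  exact: is_deriveB.
have [s /[!in_itv]/= /andP[s0 se]||s] := @MVT_segment _ phi dphi 0 e (ltW e0).
- by apply: dphiP; rewrite !ltW.
- apply: derivable_within_continuous => s /[!in_itv]/= s0e.
  by have [] := dphiP s s0e.
rewrite in_itv/= => s0e phiE.
pose psi t := 'D_u f (p + s *: u + t *: v).
have dpsiP t : 0 <= t <= e ->
    is_derive t 1 psi ('D_v ('D_u f) (p + s *: u + t *: v)).
  move=> t0e; have [_ dvu] := fd _ _ s0e t0e.
  exact: is_derive_line (derivableP dvu).
pose dpsi t := 'D_v ('D_u f) (p + s *: u + t *: v).
have [t /[!in_itv]/= /andP[t0 te]||t] := @MVT_segment _ psi dpsi 0 e (ltW e0).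
- by apply: dpsiP; rewrite !ltW.
- apply: derivable_within_continuous => t /[!in_itv]/= t0e.
  by have [] := dpsiP t t0e.
rewrite in_itv/= => t0e psiE.
exists s, t; split=> //.
move: phiE psiE; rewrite /phi /dphi /psi /dpsi !scale0r !addr0 subr0.
rewrite [p + e *: v + e *: u]addrAC [p + e *: v + s *: u]addrAC => phiE psiE.
rewrite psiE in phiE; rewrite expr2 mulrA -phiE; ring.
Qed.

(** Schwarz's theorem: the second difference with a small step e is e^2 times a
    value of either mixed derivative, so the two take a common value
    arbitrarily near p. *)
Lemma derive_comm (R : realType) (V : normedModType R) (f : V -> R)
    (p u v : V) :
  (\forall q \near p, derivable f q u /\ derivable f q v) ->
  (\forall q \near p, derivable ('D_u f) q v /\ derivable ('D_v f) q u) ->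
  {for p, continuous ('D_v ('D_u f))} ->
  {for p, continuous ('D_u ('D_v f))} ->
  'D_v ('D_u f) p = 'D_u ('D_v f) p.
Proof.
move=> fd fdd cvu cuv.
apply/eqP; rewrite -subr_eq0 -normr_le0; apply/ler_addgt0Pr => eps eps0.
have eps2 : 0 < eps / 2 by rewrite divr_gt0.
have close_vu : \forall q \near p,
    `|'D_v ('D_u f) p - 'D_v ('D_u f) q| < eps / 2.
  by move/cvgrPdist_lt : cvu; apply.
have close_uv : \forall q \near p,
    `|'D_u ('D_v f) p - 'D_u ('D_v f) q| < eps / 2.
  by move/cvgrPdist_lt : cuv; apply.
have /nbhs_ballP[r /= r0 rP] : nbhs p
    ([set q | derivable f q u /\ derivable f q v]
     `&` [set q | derivable ('D_u f) q v /\ derivable ('D_v f) q u]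
     `&` ([set q | `|'D_v ('D_u f) p - 'D_v ('D_u f) q| < eps / 2]
          `&` [set q | `|'D_u ('D_v f) p - 'D_u ('D_v f) q| < eps / 2])).
  exact: (filterI (filterI fd fdd) (filterI close_vu close_uv)).
(* With this step every p + s u + t v, 0 <= s, t <= e, lies in the ball; the 1
   makes the denominator positive when u = v = 0. *)
pose e := r / (`|u| + `|v| + 1).
have den0 : 0 < `|u| + `|v| + 1 by rewrite ltr_wpDl// addr_ge0.
have e0 : 0 < e by rewrite divr_gt0.
have in_ball s t :
    0 <= s <= e -> 0 <= t <= e -> ball p r (p + s *: u + t *: v).
  move=> /andP[s0 se] /andP[t0 te].
  rewrite -ball_normE /ball_/= -addrA opprD addNKr normrN.
  rewrite (le_lt_trans (ler_normD _ _))// !normrZ !ger0_norm//.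
  have -> : r = e * (`|u| + `|v| + 1) by rewrite /e divfK// gt_eqF.
  by rewrite !mulrDr mulr1 -[ltLHS]addr0 ler_ltD// lerD// ler_wpM2r.
have [|s [t [s0e t0e dvu]]] := @second_difference_MVT _ _ f p u v e e0.
  move=> s t s0e t0e.
  have [[[du _] [dvu _]] _] := rP _ (in_ball s t s0e t0e).
  exact: (conj du dvu).
have [|t' [s' [t'0e s'0e duv]]] := @second_difference_MVT _ _ f p v u e e0.
  move=> t' s' t'0e s'0e; rewrite addrAC.
  have [[[_ dv] [_ duv]] _] := rP _ (in_ball s' t' s'0e t'0e).
  exact: (conj dv duv).
rewrite (addrAC p (e *: v) (e *: u)) in duv.
have mixedE : 'D_v ('D_u f) (p + s *: u + t *: v) =
              'D_u ('D_v f) (p + t' *: v + s' *: u).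
  apply: (@mulIf _ (e ^+ 2)); first by rewrite expf_neq0// gt_eqF.
  apply: etrans (esym dvu) (etrans _ duv).
  by congr (_ + _); exact: addrAC.
have [_ [/= near_vu _]] := rP _ (in_ball s t s0e t0e).
have [_ [_ /= near_uv]] := rP _ (in_ball s' t' s'0e t'0e).
rewrite mixedE in near_vu.
rewrite (addrAC p (s' *: u) (t' *: v)) distrC in near_uv.
rewrite add0r [eps]splitr; apply: ltW.
exact: le_lt_trans (ler_distD _ _ _) (ltrD near_vu near_uv).
Qed.

(** Derivability of the first partial derivatives is what lets the constants
    leave the outer derivative; positivity of the determinant makes its square
    root invertible. *)
Lemma laplace_beltrami_cst (R : realType) (n : nat) (G : 'M[R]_n)
    (w : 'rV[R]_n -> R) (p : 'rV[R]_n) :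
  0 < \det G ->
  (forall i j, derivable (partial j w) p (delta_mx 0 i)) ->
  laplace_beltrami (fun=> G) w p =
  \sum_i \sum_j invmx G i j * partial i (partial j w) p.
Proof.
move=> G0 wd; apply: eq_bigr => i _; apply: eq_bigr => j _.
rewrite [in LHS]/partial (deriveMl _ (wd i j)) mulrA mulKf//.
by rewrite gt_eqF// sqrtr_gt0.
Qed.

Lemma classC2_partialC (R : realType) (n : nat) (U : set 'rV[R]_n)
    (w : 'rV[R]_n -> R) (p : 'rV[R]_n) (i j : 'I_n) :
  open U -> classC 2 U w -> U p ->
  partial i (partial j w) p = partial j (partial i w) p.
Proof.
move=> oU [_ C2] Up; have nU := open_nbhs_nbhs (conj oU Up).
have [di [_ Ci]] := C2 i; have [dj [_ Cj]] := C2 j.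
have [dij [cij _]] := Ci j; have [dji [cji _]] := Cj i.
apply: derive_comm; [| |exact: cji|exact: cij].
- by apply: filterS nU => q Uq; split; [exact: dj|exact: di].
- by apply: filterS nU => q Uq; split; [exact: dji|exact: dij].
Qed.

Lemma det_mx22 (R : comNzRingType) (A : 'M[R]_2) :
  \det A = A 0 0 * A 1 1 - A 0 1 * A 1 0.
Proof.
rewrite (expand_det_row _ 0) !big_ord_recl big_ord0 /cofactor !det_mx11 !mxE /=.
rewrite expr0 mul1r expr1 addr0 mulN1r mulrN.
by congr (_ * A _ _ - A _ _ * A _ _); apply: val_inj.
Qed.

Lemma trinition_det (R : realType) (alpha : R) :
  \det (trinition_mx alpha) = alpha * (2 - alpha).
Proof.
rewrite (expand_det_row _ ord0) !big_ord_recl big_ord0 /cofactor !det_mx22.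
by rewrite !mxE /=; ring.
Qed.

Lemma trinition_mulVmx (R : realType) (alpha : R) :
  alpha * (2 - alpha) != 0 ->
  trinition_inv alpha *m trinition_mx alpha = 1%:M.
Proof.
move=> d0; apply/matrixP => i j.
(* The nonvanishing condition in the form in which field asks for it. *)
rewrite mulf_eq0 negb_or andbC in d0.
rewrite !mxE !big_ord_recl big_ord0 !mxE.
by case: i => [[|[|[|//]]] ?]; case: j => [[|[|[|//]]] ?] //=; field.
Qed.

(** The symmetry of D merges its two mixed terms, hence the factor 2. *)
Lemma trinition_inv_contract (R : realType) (alpha : R)
    (D : 'I_3 -> 'I_3 -> R) :
  let d := alpha * (2 - alpha) in
  D iz iy = D iy iz ->
  \sum_i \sum_j trinition_inv alpha i j * D i j =
  D ix ix + 1 / d * D iy iy + 2 * ((1 - alpha) / d) * D iy iz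
  + 1 / d * D iz iz.
Proof.
move=> d symD; rewrite !big_ord_recl !big_ord0 !mxE /=.
rewrite (_ : lift ord0 ord0 = iy); last exact: val_inj.
rewrite (_ : lift ord0 (lift ord0 ord0) = iz); last exact: val_inj.
rewrite (_ : ord0 = ix); last exact: val_inj.
by rewrite symD -/d; ring.
Qed.

Theorem mainTheorem9 (R : realType) (alpha : R) :
  let g := trinition_mx alpha in
  let ginv := trinition_inv alpha in
  let d := alpha * (2 - alpha) in
  [/\ (* the quadratic form of g *)
      forall x y z : R,
        (vec3 x y z *m g *m (vec3 x y z)^T) 0 0 =
        x ^+ 2 + y ^+ 2 + z ^+ 2 - 2 * (1 - alpha) * y * z,
      (* the determinant of the (y, z) block, and that of g *)
      [/\ \det (row' ix (col' ix g)) = 1 - (1 - alpha) ^+ 2,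
          1 - (1 - alpha) ^+ 2 = d
        & \det g = d],
      (* the inverse metric *)
      d != 0 ->
        [/\ g \in unitmx, invmx g = ginv
          & forall i j : 'I_3, \sum_k ginv i k * g k j = (i == j)%:R]
    & (* the Laplace-Beltrami operator *)
      0 < d ->
        (forall p, Num.sqrt (\det (trinition_metric alpha p)) = Num.sqrt d) /\
        (forall (U : set 'rV[R]_3) (w : 'rV[R]_3 -> R),
           open U -> classC 2 U w ->
           forall p, U p ->
             laplace_beltrami (trinition_metric alpha) w p =
               \sum_i \sum_j ginv i j * partial i (partial j w) p
             /\
             laplace_beltrami (trinition_metric alpha) w p =
               partial ix (partial ix w) p
               + 1 / d * partial iy (partial iy w) p
               + 2 * ((1 - alpha) / d) * partial iy (partial iz w) p
               + 1 / d * partial iz (partial iz w) p)].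
Proof.
move=> g ginv d.
have gV : d != 0 -> ginv *m g = 1%:M by exact: trinition_mulVmx.
have gU : d != 0 -> g \in unitmx by move/gV/mulmx1_unit => [].
have gVE : d != 0 -> invmx g = ginv.
  by move=> d0; rewrite -[LHS]mul1mx -(gV d0) mulmxK// gU.
split.
- move=> x y z.
  rewrite mxE !big_ord_recl big_ord0 !mxE !big_ord_recl !big_ord0 !mxE /=.
  ring.
- split; [|rewrite /d; ring|exact: trinition_det].
  by rewrite det_mx22 !mxE /=; ring.
- move=> d0; split; [exact: gU|exact: gVE|].
  by move=> i j; move/matrixP/(_ i j) : (gV d0); rewrite !mxE.
- move=> d0; split; first by move=> p; rewrite trinition_det.
  move=> U w oU wC p Up.
  have lapE : laplace_beltrami (trinition_metric alpha) w p =
      \sum_i \sum_j ginv i j * partial i (partial j w) p.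
    rewrite -(gVE (lt0r_neq0 d0)).
    apply: laplace_beltrami_cst; first by rewrite trinition_det.
    by move=> i j; have [_ /(_ j)[_ [_ /(_ i)[+ _]]]] := wC; exact.
  split; first exact: lapE.
  apply: etrans lapE _; apply: trinition_inv_contract.
  exact: classC2_partialC oU wC Up.
Qed.
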